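(* Let $P$ be the Borel probability measure on $\mathbb{R}$ with $P(\{k\})=2^{-k}$ for every $k\in\mathbb{N}=\{1,2,3,\dots\}$. Let $n\ge4$ be an integer and let $\alpha_n$ be an optimal set of $n$-means for $P$. Then either $$\alpha_n=\{1,2,3,\dots,n-3,\,n-2,\,Av[n-1,n],\,Av[n+1,\infty)\}$$ or $$\alpha_n=\{1,2,3,\dots,n-3,\,Av[n-2,n-1],\,Av[n,n+1],\,Av[n+2,\infty)\},$$ with $n$th quantization error $V_n(P)=\frac{2^{3-n}}{3}$.
   Context: For a Borel probability measure $P$ on $\mathbb{R}$ and a nonempty finite set $\alpha\subset\mathbb{R}$, the distortion error is $V(P;\alpha)=\int\min_{a\in\alpha}|x-a|^2\,dP(x)$. The $n$th quantization error is $V_n(P)=\inf\{V(P;\alpha):\alpha\subset\mathbb{R},\ 1\le\mathrm{card}(\alpha)\le n\}$, and a set $\alpha$ with $1\le\mathrm{card}(\alpha)\le n$ attaining this infimum is called an optimal set of $n$-means for $P$. For integers $1\le k\le\ell$ put $Av[k,\ell]=\dfrac{\sum_{j=k}^{\ell}j2^{-j}}{\sum_{j=k}^{\ell}2^{-j}}$ and $Av[k,\infty)=\dfrac{\sum_{j=k}^{\infty}j2^{-j}}{\sum_{j=k}^{\infty}2^{-j}}$. *)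

(* Defs.v *)
From HB Require Import structures.
From mathcomp Require Import all_boot all_order all_algebra finmap.
From mathcomp Require Import all_classical all_reals all_analysis.
Set Implicit Arguments.
Unset Strict Implicit.
Unset Printing Implicit Defensive.
Import Order.TTheory GRing.Theory Num.Theory.
Import numFieldNormedType.Exports.
Local Open Scope classical_set_scope.
Local Open Scope ring_scope.

(* The minimum over alpha is taken in \bar R so that the empty minimum is +oo;
   for nonempty alpha it is the real number min_(a in alpha) |x - a|^2. *)
Definition min_sq_dist (R : realType) (alpha : {fset R}) (x : R) : \bar R :=
  \big[mine/+oo%E]_(a <- alpha) (`|x - a| ^+ 2)%:E.

(* Valued in \bar R: the integral may be infinite when P has no second
   moment. *)
Definition distortion (R : realType) (P : probability (measurableTypeR R) R)
    (alpha : {fset R}) : \bar R :=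
  (\int[P]_x min_sq_dist alpha x)%E.

Definition quantization_error (R : realType)
    (P : probability (measurableTypeR R) R) (n : nat) : \bar R :=
  ereal_inf [set distortion P alpha |
             alpha in [set alpha : {fset R} | (1 <= #|` alpha| <= n)%N]].

Definition optimal_set (R : realType) (P : probability (measurableTypeR R) R)
    (n : nat) (alpha : {fset R}) : Prop :=
  (1 <= #|` alpha| <= n)%N /\ distortion P alpha = quantization_error P n.

Definition Av (R : realType) (k l : nat) : R :=
  (\sum_(k <= j < l.+1) j%:R * 2 ^- j) / (\sum_(k <= j < l.+1) 2 ^- j).

Definition Av_infty (R : realType) (k : nat) : R :=
  limn (fun m => \sum_(k <= j < m) (j%:R * 2 ^- j : R)) /
  limn (fun m => \sum_(k <= j < m) (2 ^- j : R)).

(* Main.v *)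
(** The law is self-similar: conditioned on [x > L] and translated by [-L] it is the same law again.
    Hence, if the smallest of [m + 1] means serves the support points [1, ..., L], the error is
    [c_L(a) + 2^-L D'], where [c_L(a)] is the cost of that block and [D'] is the error of the other
    [m] means translated by [-L].  With [E_m] the optimal error this gives
    [E_(m+1) = min_L (min_a c_L(a) + 2^-L E_m)], where [min_a c_L(a)] is [0], [1/6], [13/28]
    and [97/120] for [L] equal to 1, 2, 3 and 4 and does not decrease with [L].
    From [E_1 = 2] one finds [E_2 = 2/3] (only [L = 2]), [E_3 = 1/3] (a tie between [L = 1] and
    [L = 2], whence the two optimal sets), and afterwards only [L = 1] is optimal. *)
Require Import Defs.
From HB Require Import structures.
From mathcomp Require Import all_boot all_order all_algebra finmap.
From mathcomp Require Import all_classical all_reals all_analysis.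
From mathcomp Require Import measurable_realfun ring lra zify.
Import Order.TTheory GRing.Theory Num.Theory.
Import numFieldNormedType.Exports.
Local Open Scope classical_set_scope.
Local Open Scope ring_scope.

(** * The error of a list of means as a series, and its self-similarity *)

Definition sq_dist {R : realType} (s : seq R) (x : R) : \bar R :=
  \big[mine/+oo%E]_(a <- s) (`|x - a| ^+ 2)%:E.

(** The index [k] stands for the support point [k + 1]. Lists replace finite sets so that the
    smallest mean can be split off. *)
Definition seq_distortion {R : realType} (s : seq R) : \bar R :=
  (\sum_(0 <= k <oo) (2 ^- k.+1)%:E * sq_dist s k.+1%:R)%E.

Definition block_cost {R : realType} (L : nat) (a : R) : R :=
  \sum_(0 <= k < L) 2 ^- k.+1 * (k.+1%:R - a) ^+ 2.

Definition shift_left {R : realType} (L : nat) (s : seq R) : seq R :=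
  [seq x - L%:R | x <- s].

Lemma sq_dist_ge0 {R : realType} (s : seq R) (x : R) : (0 <= sq_dist s x)%E.
Proof.
apply: (big_ind (fun y : \bar R => (0 <= y)%E)) => // y z y0 z0.
by rewrite le_min y0.
Qed.

Lemma sq_dist_shift {R : realType} (L : nat) (s : seq R) (x : R) :
  sq_dist (shift_left L s) x = sq_dist s (x + L%:R).
Proof.
rewrite /sq_dist big_map; apply: eq_bigr => a _.
by rewrite opprB addrA.
Qed.

Lemma sq_dist_head {R : realType} (a : R) (s : seq R) (x : R) :
  (forall b, b \in s -> `|x - a| <= `|x - b|) ->
  sq_dist (a :: s) x = ((x - a) ^+ 2)%:E.
Proof.
move=> near; rewrite /sq_dist big_cons real_normK ?num_real//.
apply/min_idPl; rewrite big_seq.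
apply: (big_ind (fun y => ((x - a) ^+ 2)%:E <= y)%E) => [|y z ay az|b bs].
- exact: leey.
- by rewrite le_min ay.
- by rewrite lee_fin -(@real_normK _ (x - a)) ?num_real// lerXn2r ?nnegrE ?near.
Qed.

Lemma weighted_sq_dist_ge0 {R : realType} (s : seq R) (k : nat) :
  (0 <= (2 ^- k.+1)%:E * sq_dist s k.+1%:R)%E.
Proof. by rewrite mule_ge0 ?sq_dist_ge0// lee_fin invr_ge0 exprn_ge0. Qed.

Lemma seq_distortion_ge0 {R : realType} (s : seq R) : (0 <= seq_distortion s)%E.
Proof. by apply: nneseries_ge0 => k _ _; exact: weighted_sq_dist_ge0. Qed.

(** The point [L + j] carries [2^-L] times the mass of [j], so the tail beyond [L] is a scaled copy
    of the whole series once the means are translated by [-L]. *)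
Lemma seq_distortion_split {R : realType} (L : nat) (s : seq R) :
  seq_distortion s =
  (\sum_(0 <= k < L) (2 ^- k.+1)%:E * sq_dist s k.+1%:R +
   (2 ^- L)%:E * seq_distortion (shift_left L s))%E.
Proof.
rewrite /seq_distortion (nneseries_split 0 L) => [|k _]; last exact: weighted_sq_dist_ge0.
congr (_ + _)%E; rewrite add0n -nneseries_addn => [|k]; last exact: weighted_sq_dist_ge0.
rewrite -nneseriesZl => [|k _]; last exact: weighted_sq_dist_ge0.
apply: eq_eseriesr => k _.
by rewrite sq_dist_shift muleA -EFinM -invfM -exprD -natrD addnS addSn addnC.
Qed.

(** Charging the points up to [L] to [a] and the later ones to [s] can only overestimate the
    distance to the nearest mean. This yields upper bounds for explicit configurations. *)
Lemma seq_distortion_cons_le {R : realType} (L : nat) (a : R) (s : seq R) :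
  (seq_distortion (a :: s) <=
   (block_cost L a)%:E + (2 ^- L)%:E * seq_distortion (shift_left L s))%E.
Proof.
rewrite (seq_distortion_split L); apply: leeD.
- rewrite /block_cost -sumEFin; apply: lee_sum => k _.
  rewrite EFinM lee_wpmul2l ?lee_fin ?invr_ge0 ?exprn_ge0//.
  by rewrite /sq_dist big_cons ge_min real_normK ?num_real ?lexx.
- rewrite lee_wpmul2l ?lee_fin ?invr_ge0 ?exprn_ge0//.
  apply: lee_nneseries => [k _ _|k _]; first exact: weighted_sq_dist_ge0.
  rewrite lee_wpmul2l ?lee_fin ?invr_ge0 ?exprn_ge0//.
  by rewrite /sq_dist [leLHS]big_cons ge_min lexx orbT.
Qed.

(* [L] counts the support points up to the midpoint of the two smallest means. *)
Lemma seq_distortion_peel {R : realType} (a b : R) (s : seq R) (r : R) :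
  sorted <%R [:: a, b & s] -> seq_distortion [:: a, b & s] = r%:E ->
  exists L r', seq_distortion (shift_left L (b :: s)) = r'%:E /\
    r = block_cost L a + 2 ^- L * r'.
Proof.
(* A negative midpoint truncates to [0]: the block is then empty and [a] serves no support point. *)
move=> /= /andP[ab bs]; set L := Num.truncn ((a + b) / 2).
have hs c : c \in b :: s -> b <= c.
  rewrite inE => /predU1P[->//|cs]; apply/ltW.
  by move: bs; rewrite (path_sortedE lt_trans) => /andP[/allP/(_ _ cs)].
rewrite (seq_distortion_split L).
have -> : (\sum_(0 <= k < L) (2 ^- k.+1)%:E * sq_dist [:: a, b & s] k.+1%:R)%E =
    (block_cost L a)%:E.
  rewrite /block_cost -sumEFin; apply: eq_big_nat => k /= kL.
  rewrite EFinM sq_dist_head// => c /hs bc; move: kL; rewrite truncn_gt_nat => kL.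
  rewrite [leRHS]distrC [leRHS]ger0_norm; last by lra.
  by rewrite ler_norml; apply/andP; split; lra.
(* Points above the midpoint are at least as close to [b] as to [a], so [a] drops out of the
   minimum. *)
have -> : seq_distortion (shift_left L [:: a, b & s]) =
    seq_distortion (shift_left L (b :: s)).
  apply: eq_eseriesr => k _; congr (_ * _)%E.
  rewrite !sq_dist_shift /sq_dist big_cons; apply/min_idPr.
  rewrite big_cons ge_min; apply/orP; left; rewrite lee_fin.
  have : (a + b) / 2 < L.+1%:R by exact: truncnS_gt.
  have : (0 : R) <= k%:R by [].
  rewrite -[L.+1%:R]natr1 -[k.+1%:R]natr1 => k0 hL; rewrite !real_normK ?num_real//.
  (* With [x = k + 1 + L], this is [(x - a)^2 - (x - b)^2 = (b - a)(2x - (a + b))]. *)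
  rewrite -subr_ge0 (_ : _ - _ = (b - a) * ((k%:R + 1 + L%:R) * 2 - (a + b))); last by ring.
  by apply: mulr_ge0; lra.
have := seq_distortion_ge0 (shift_left L (b :: s)).
case E: (seq_distortion (shift_left L (b :: s))) => [r'| |]// _.
- by rewrite -EFinM -EFinD => -[<-]; exists L, r'.
(* An infinite tail stays infinite after scaling by [2^-L > 0], against the finite total [r]. *)
- by rewrite gt0_muley ?lte_fin ?invr_gt0 ?exprn_gt0.
Qed.

(** * Decay estimates, and the cost of one block *)

Lemma cube_le_exp2 (n : nat) : (n.+1 ^ 3 <= 8 * 2 ^ n)%N.
Proof.
(* The small cases are computed; from there on [(m + 1)^3 <= 2 m^3] for [m >= 4], as
   [(5/4)^3 < 2]. *)
elim: n => // -[|[|[|n]]] // IH; rewrite expnS [(2 ^ n.+4)%N]expnS.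
move: IH; rewrite !expnS expn0; nia.
Qed.

Lemma cvg_sqr_exp2 {R : realType} : (n.+1%:R ^+ 2 * 2 ^- n : R) @[n --> \oo] --> 0.
Proof.
have h : (8 * harmonic n : R) @[n --> \oo] --> 0.
  by rewrite -[X in _ --> X](mulr0 8); apply: cvgMl_tmp; exact: cvg_harmonic.
apply: squeeze_cvgr (@cvg_cst _ (0 : R) _ _ _) h.
apply: nearW => n; rewrite mulr_ge0 ?invr_ge0 ?exprn_ge0//=.
rewrite ler_pdivrMr ?exprn_gt0// mulrAC ler_pdivlMr// -exprSr -!natrX -natrM ler_nat.
exact: cube_le_exp2.
Qed.

(** The law has mean 2 and variance 2, so [2 + (a - 2)^2] is the cost of the whole support. The
    subtracted term is the cost of the tail, [2^-L] times the same expression at [a - L]. *)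
Lemma block_costE {R : realType} (L : nat) (a : R) :
  block_cost L a = 2 + (a - 2) ^+ 2 - 2 ^- L * ((L%:R - a + 2) ^+ 2 + 2).
Proof.
rewrite /block_cost; elim: L => [|L IH]; first by rewrite big_geq// expr0 invr1; ring.
rewrite big_nat_recr//= IH -[L.+1%:R]natr1 [2 ^+ L.+1]exprS; field.
by rewrite expf_neq0.
Qed.

Lemma cvg_block_cost {R : realType} (a : R) :
  block_cost L a @[L --> \oo] --> 2 + (a - 2) ^+ 2.
Proof.
suff h : (2 ^- L * ((L%:R - a + 2) ^+ 2 + 2) : R) @[L --> \oo] --> 0.
  rewrite -[2 + (a - 2) ^+ 2]subr0; apply: cvg_trans (cvgB (cvg_cst _) h).
  by apply: near_eq_cvg; apply: nearW => L; rewrite block_costE.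
(* The domination uses [|L - a + 2| <= (2 + |a|)(L + 1)] and [1 <= (L + 1)^2]. *)
have h : (((2 + `|a|) ^+ 2 + 2) * (L.+1%:R ^+ 2 * 2 ^- L) : R) @[L --> \oo] --> 0.
  by rewrite -[X in _ --> X](mulr0 ((2 + `|a|) ^+ 2 + 2)); apply: cvgMl_tmp; exact: cvg_sqr_exp2.
apply: squeeze_cvgr (@cvg_cst _ (0 : R) _ _ _) h.
apply: nearW => L; apply/andP; split.
  by rewrite mulr_ge0 ?invr_ge0 ?exprn_ge0// addr_ge0 ?sqr_ge0.
rewrite mulrA mulrC ler_wpM2r ?invr_ge0 ?exprn_ge0// -[L.+1%:R]natr1.
have L0 : 0 <= L%:R :> R by [].
have a0 := normr_ge0 a.
have : (L%:R - a + 2) ^+ 2 <= ((2 + `|a|) * (L%:R + 1)) ^+ 2.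
  rewrite -(real_normK (num_real (_ - a + 2))) lerXn2r ?nnegrE//.
  have := ler_norm a; have := ler_norm (- a); rewrite normrN => h1 h2.
  by rewrite ler_norml; apply/andP; split; nra.
have : 1 <= (L%:R + 1) ^+ 2 :> R by nra.
rewrite exprMn; nra.
Qed.

Lemma seq_distortion1 {R : realType} (a : R) :
  seq_distortion [:: a] = (2 + (a - 2) ^+ 2)%:E.
Proof.
rewrite /seq_distortion; apply/cvg_lim => //.
under eq_fun => n.
  under eq_bigr => k _.
    rewrite sq_dist_head => [|b]; last by rewrite in_nil.
    rewrite -EFinM.
    over.
  rewrite sumEFin.
  over.
by apply: cvg_EFin; [exact: nearW|exact: cvg_block_cost].
Qed.

Lemma le_block_cost {R : realType} (a : R) (L M : nat) :
  (L <= M)%N -> block_cost L a <= block_cost M a.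
Proof.
move=> LM; rewrite /block_cost (big_cat_nat _ LM)//= lerDl sumr_ge0// => k _.
by rewrite mulr_ge0 ?sqr_ge0// invr_ge0 exprn_ge0.
Qed.

Lemma block_cost0 {R : realType} (a : R) : block_cost 0 a = 0.
Proof. by rewrite /block_cost big_geq. Qed.

Lemma block_cost1 {R : realType} (a : R) : block_cost 1 a = (a - 1) ^+ 2 / 2.
Proof. by rewrite /block_cost big_nat1; field. Qed.

Lemma block_cost2 {R : realType} (a : R) :
  block_cost 2 a = 1 / 6 + 3 / 4 * (a - 4 / 3) ^+ 2.
Proof. by rewrite block_costE; field. Qed.

(** By monotonicity in [L] it suffices to take [L = 3], where the cost is a quadratic in [a] with
    vertex [11/7], the conditional mean of [{1, 2, 3}]. *)
Lemma block_cost_ge3 {R : realType} (a : R) (L : nat) :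
  (3 <= L)%N -> 13 / 28 <= block_cost L a.
Proof.
move=> /(le_block_cost a); apply: le_trans; rewrite block_costE.
by have := sqr_ge0 (a - 11 / 7); lra.
Qed.

(** Same argument with [26/15], the conditional mean of [{1, 2, 3, 4}]. *)
Lemma block_cost_ge4 {R : realType} (a : R) (L : nat) :
  (4 <= L)%N -> 97 / 120 <= block_cost L a.
Proof.
move=> /(le_block_cost a); apply: le_trans; rewrite block_costE.
by have := sqr_ge0 (a - 26 / 15); lra.
Qed.

Lemma sorted_shift_left {R : realType} (L : nat) (s : seq R) :
  sorted <%R s -> sorted <%R (shift_left L s).
Proof. by rewrite sorted_map; apply: sub_sorted => x y /= xy; rewrite ltrD2r. Qed.

Lemma shift_leftK {R : realType} (L : nat) (s t : seq R) :
  shift_left L s = t -> s = [seq x + L%:R | x <- t].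
Proof. by move=> <-; rewrite -map_comp map_id_in// => x _ /=; rewrite subrK. Qed.

(** * Lower bounds and minimisers for two, three and more means *)

Lemma seq_distortion2_min {R : realType} (a b r : R) :
  a < b -> seq_distortion [:: a; b] = r%:E ->
  2 / 3 <= r /\ (r = 2 / 3 -> a = 4 / 3 /\ b = 4).
Proof.
move=> ab /seq_distortion_peel[|L [r' []]]; first by rewrite /= ab.
rewrite seq_distortion1 => -[<-] ->{r}.
case: L => [|[|[|[|L]]]].
- rewrite block_cost0; have := sqr_ge0 (b - 0%:R - 2); rewrite expr0 invr1; split; lra.
- rewrite block_cost1 expr1; have := sqr_ge0 (b - 1%:R - 2); have := sqr_ge0 (a - 1); split; lra.
- rewrite block_cost2; have := sqr_ge0 (b - 2%:R - 2); have := sqr_ge0 (a - 4 / 3).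
  move=> a0 b0; split; first by lra.
  move=> e; have /eqP : (a - 4 / 3) ^+ 2 = 0 by lra.
  have /eqP : (b - 2%:R - 2) ^+ 2 = 0 by lra.
  by rewrite !sqrf_eq0 => /eqP ? /eqP ?; split; lra.
(* Here [13/28] alone is below [2/3]; the tail contributes at least [2/8] more. From [L = 4] on, the
   block alone exceeds [2/3]. *)
- have := @block_cost_ge3 R a 3 erefl; have := sqr_ge0 (b - 3%:R - 2); split; lra.
- have := @block_cost_ge4 R a L.+4 erefl; set t := 2 ^- _ * _.
  have : 0 <= t by rewrite mulr_ge0 ?invr_ge0 ?exprn_ge0// addr_ge0 ?sqr_ge0.
  split; lra.
Qed.

Lemma seq_distortion3_min {R : realType} {s : seq R} {r : R} :
  size s = 3 -> sorted <%R s -> seq_distortion s = r%:E ->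
  1 / 3 <= r /\
  (r = 1 / 3 -> s = [:: 1; 7 / 3; 5] \/ s = [:: 4 / 3; 10 / 3; 6]).
Proof.
case: s => [|a [|b [|c []]]]//= _ abc /seq_distortion_peel[//|L [r' [/= hr' ->{r}]]].
have bc : b < c by case/and3P: abc.
have [r'min r'eq] : 2 / 3 <= r' /\ (r' = 2 / 3 -> b - L%:R = 4 / 3 /\ c - L%:R = 4).
  by apply: seq_distortion2_min hr'; rewrite ltrD2r.
(* The tie: [L = 1] gives [0 + (1/2)(2/3)] and [L = 2] gives [1/6 + (1/4)(2/3)], both [1/3]. The
   optimal pair [4/3, 4] is translated back by [L]. *)
case: L r'eq {hr'} => [|[|[|L]]] r'eq.
- by rewrite block_cost0 expr0 invr1; split=> [|?]; [|exfalso]; lra.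
- rewrite block_cost1 expr1; have a0 := sqr_ge0 (a - 1); split; first by lra.
  move=> e; left; have /eqP : (a - 1) ^+ 2 = 0 by lra.
  have /r'eq[? ?] : r' = 2 / 3 by lra.
  by rewrite sqrf_eq0 => /eqP ?; congr [:: _; _; _]; lra.
- rewrite block_cost2; have a0 := sqr_ge0 (a - 4 / 3); split; first by lra.
  move=> e; right; have /eqP : (a - 4 / 3) ^+ 2 = 0 by lra.
  have /r'eq[? ?] : r' = 2 / 3 by lra.
  by rewrite sqrf_eq0 => /eqP ?; congr [:: _; _; _]; lra.
- have := @block_cost_ge3 R a L.+3 erefl; set t := 2 ^- _ * _.
  have : 0 <= t by rewrite mulr_ge0 ?invr_ge0 ?exprn_ge0//; lra.
  by split=> [|?]; [|exfalso]; lra.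
Qed.

Lemma seq_distortion_min {R : realType} (p : nat) (s : seq R) (r : R) :
  size s = p.+3 -> sorted <%R s -> seq_distortion s = r%:E ->
  2 ^- p / 3 <= r /\
  (r = 2 ^- p / 3 -> exists2 t, t = [:: 1; 7 / 3; 5] \/ t = [:: 4 / 3; 10 / 3; 6] &
     s = [seq k%:R | k <- iota 1 p] ++ [seq x + p%:R | x <- t]).
Proof.
elim: p s r => [|p IH] s r hs sorted_s hr.
  rewrite expr0 invr1; have [h1 h2] := seq_distortion3_min hs sorted_s hr.
  split=> // /h2 h; exists s => //=.
  by under eq_map do rewrite addr0; rewrite map_id.
case: s hs sorted_s hr => [|a [|b s]]// [hs] sorted_s.
move=> /(seq_distortion_peel _ _ _ _ sorted_s)[L [r' [hr' ->{r}]]].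
have {IH hr'}[r'min r'eq] : 2 ^- p / 3 <= r' /\ (r' = 2 ^- p / 3 ->
    exists2 t, t = [:: 1; 7 / 3; 5] \/ t = [:: 4 / 3; 10 / 3; 6] &
    shift_left L (b :: s) = [seq k%:R | k <- iota 1 p] ++ [seq x + p%:R | x <- t]).
  apply: IH hr'; first by rewrite /= size_map hs.
  by apply: (sorted_shift_left L (b :: s)); exact: path_sorted sorted_s.
have p0 : 0 < 2 ^- p :> R by rewrite invr_gt0 exprn_gt0.
have p1 : 2 ^- p <= 1 :> R by rewrite invf_le1 ?exprn_gt0// exprn_ege1// ler1n.
rewrite exprS invfM; clear hs.
case: L r'eq => [|[|[|L]]] r'eq.
- by move: r'eq => _; rewrite block_cost0 expr0 invr1; split=> [|?]; [|exfalso]; lra.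
- rewrite block_cost1 expr1; have a0 := sqr_ge0 (a - 1); split; first by move: r'eq => _; lra.
  move=> e; have [/eqP] : (a - 1) ^+ 2 = 0 /\ r' = 2 ^- p / 3 by move: r'eq => _; split; lra.
  move=> a1 /r'eq[t ht st]; move: a1.
  rewrite sqrf_eq0 subr_eq0 => /eqP ->; exists t => //.
  (* Translating back by 1 sends [1, ..., p] to [2, ..., p + 1] and the offset [p] of [t] to
     [p + 1]; the new mean 1 goes in front. *)
  rewrite (shift_leftK _ _ _ st) map_cat -!map_comp /=; congr (_ :: _ ++ _).
    rewrite -[2%N]/(1 + 1)%N iotaDl -map_comp; apply: eq_map => k /=.
    by rewrite natrD addrC.
  by apply: eq_map => x /=; rewrite -addrA natr1.
(* Since [2^-p <= 1], the block cost [1/6] already reaches the target [2^-p / 6], and the positive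
   tail makes [L = 2] strictly worse. *)
- move: r'eq => _; rewrite block_cost2; have a0 := sqr_ge0 (a - 4 / 3).
  by split=> [|?]; [|exfalso]; lra.
- move: r'eq => _; have := @block_cost_ge3 R a L.+3 erefl; set t := 2 ^- _ * _.
  have : 0 <= t by rewrite mulr_ge0 ?invr_ge0 ?exprn_ge0//; lra.
  by split=> [|?]; [|exfalso]; lra.
Qed.

(** * A configuration attaining the bound, and configurations with fewer means *)

Fixpoint opt_means {R : realType} (p : nat) : seq R :=
  if p is q.+1 then 1 :: [seq x + 1 | x <- opt_means q] else [:: 1; 7 / 3; 5].

Lemma size_opt_means {R : realType} (p : nat) : size (@opt_means R p) = p.+3.
Proof. by elim: p => //= p <-; rewrite size_map. Qed.

Lemma opt_means_distortion {R : realType} (p : nat) :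
  (seq_distortion (@opt_means R p) <= (2 ^- p / 3)%:E)%E.
Proof.
elim: p => [|p IH] /=.
  apply: le_trans (seq_distortion_cons_le 1 _ _) _.
  (* The translated pair is [4/3, 4]; splitting it at [L = 2] costs [1/6 + (1/4) * 2]. *)
  have h : (seq_distortion (shift_left 1 [:: 7 / 3; 5 : R]%R) <= (2 / 3)%:E)%E.
    apply: le_trans (seq_distortion_cons_le 2 _ _) _.
    rewrite /= seq_distortion1 -EFinM -EFinD lee_fin block_cost2; lra.
  apply: le_trans (leeD2l _ (lee_wpmul2l _ h)) _; first by rewrite lee_fin invr_ge0.
  rewrite -EFinM -EFinD lee_fin block_cost1; lra.
apply: le_trans (seq_distortion_cons_le 1 _ _) _.
have -> : shift_left 1 [seq x + 1 | x <- @opt_means R p] = opt_means p.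
  by rewrite /shift_left -map_comp map_id_in// => x _ /=; rewrite addrK.
apply: le_trans (leeD2l _ (lee_wpmul2l _ IH)) _; first by rewrite lee_fin invr_ge0.
by rewrite -EFinM -EFinD lee_fin block_cost1 [2 ^+ p.+1]exprS invfM; lra.
Qed.

(** An optimal set is only known to have at most [n] elements. Fewer means are strictly worse: one
    costs at least 2, two at least [2/3], and beyond that the bound halves with each added mean. *)
Lemma seq_distortion_min_le {R : realType} (p : nat) (s : seq R) (r : R) :
  (0 < size s <= p.+3)%N -> sorted <%R s -> seq_distortion s = r%:E ->
  2 ^- p / 3 <= r /\ (r = 2 ^- p / 3 -> size s = p.+3).
Proof.
move=> /andP[s0 sp] ss hr.
have p0 : 0 < 2 ^- p :> R by rewrite invr_gt0 exprn_gt0.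
have p1 : 2 ^- p <= 1 :> R by rewrite invf_le1 ?exprn_gt0// exprn_ege1// ler1n.
case: s s0 sp ss hr => [|a [|b [|c s]]]// _ sp ss hr.
- have := sqr_ge0 (a - 2); move: hr; rewrite seq_distortion1 => -[<-] ?.
  by split=> [|?]; [|exfalso]; lra.
- have [] := @seq_distortion2_min R a b r _ hr; first by case/andP: ss.
  by split=> [|?]; [|exfalso]; lra.
- have [h _] := @seq_distortion_min R (size s) [:: a, b, c & s] r erefl ss hr.
  move: sp; rewrite !ltnS leq_eqVlt => /predU1P[<-|sp]; first by split=> // ->.
  have : 2 ^- p < 2 ^- size s :> R.
    by rewrite ltf_pV2 ?posrE ?exprn_gt0// ltr_eXn2l ?ltr1n.
  by split=> [|?]; [|exfalso]; lra.
Qed.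

(** * Closed forms of the conditional means [Av] and [Av_infty] *)

Lemma sum_exp2 {R : realType} (k m : nat) :
  \sum_(k <= j < k + m) (2 ^- j : R) = 2 * 2 ^- k - 2 * 2 ^- (k + m).
Proof.
elim: m => [|m IH]; first by rewrite addn0 big_geq// subrr.
by rewrite addnS big_nat_recr ?leq_addr//= IH [2 ^+ (k + m).+1]exprS invfM; field;
  rewrite !expf_neq0.
Qed.

(** The sum telescopes: [j 2^-j] is the decrement of [2 (j + 1) 2^-j] from [j] to [j + 1]. *)
Lemma sum_mul_exp2 {R : realType} (k m : nat) :
  \sum_(k <= j < k + m) (j%:R * 2 ^- j : R) =
  2 * (k%:R + 1) * 2 ^- k - 2 * ((k + m)%:R + 1) * 2 ^- (k + m).
Proof.
elim: m => [|m IH]; first by rewrite addn0 big_geq// subrr.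
rewrite addnS big_nat_recr ?leq_addr//= IH [2 ^+ (k + m).+1]exprS invfM.
by rewrite -[(k + m).+1%:R]natr1; field; rewrite !expf_neq0.
Qed.

Lemma cvg_exp2 {R : realType} : (2 ^- n : R) @[n --> \oo] --> 0.
Proof.
apply: squeeze_cvgr (@cvg_cst _ (0 : R) _ _ _) (@cvg_sqr_exp2 R).
apply: nearW => n; rewrite invr_ge0 exprn_ge0//= ler_peMl ?invr_ge0 ?exprn_ge0//.
by rewrite exprn_ege1// ler1n.
Qed.

Lemma cvg_mul_exp2 {R : realType} : ((n%:R + 1) * 2 ^- n : R) @[n --> \oo] --> 0.
Proof.
apply: squeeze_cvgr (@cvg_cst _ (0 : R) _ _ _) (@cvg_sqr_exp2 R).
apply: nearW => n; rewrite natr1 mulr_ge0 ?invr_ge0 ?exprn_ge0//=.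
by rewrite ler_wpM2r ?invr_ge0 ?exprn_ge0// ler_eXnr// ler1n.
Qed.

(** The closed forms hold only from index [k] on, the sums being empty before it; hence the argument
    [k + m]. *)
Lemma lim_tailE {R : realType} (u v : nat -> R) (k : nat) (c : R) :
  v n @[n --> \oo] --> 0 -> (forall m, u (k + m)%N = c - 2 * v (k + m)%N) ->
  limn u = c.
Proof.
move=> v0 uv; apply/cvg_lim => //.
have h : (c - 2 * v n) @[n --> \oo] --> c - 2 * 0.
  by apply: cvgB; [exact: cvg_cst|exact: cvgMl_tmp].
rewrite mulr0 subr0 in h; apply: cvg_trans h; apply: near_eq_cvg; near=> n.
have /subnKC <- : (k <= n)%N by near: n; exact: nbhs_infty_ge.
by rewrite uv.
Unshelve. all: by end_near.
Qed.

Lemma Av_inftyE {R : realType} (k : nat) : Av_infty R k = k%:R + 1.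
Proof.
rewrite /Av_infty (@lim_tailE _ _ _ k (2 * (k%:R + 1) * 2 ^- k) cvg_mul_exp2); last first.
  by move=> m; rewrite sum_mul_exp2 !mulrA.
rewrite (@lim_tailE _ _ _ k (2 * 2 ^- k) cvg_exp2); last by move=> m; exact: sum_exp2.
by field; rewrite expf_neq0.
Qed.

Lemma Av_pair {R : realType} (k : nat) : Av R k k.+1 = k%:R + 1 / 3.
Proof.
rewrite /Av !big_nat_recr//= !big_geq//= !add0r -[k.+1%:R]natr1 [2 ^+ k.+1]exprS.
by field; rewrite expf_neq0.
Qed.

(** * From the measure to the series, and the theorem *)

Lemma eq_mem_seq_distortion {R : realType} (s t : seq R) :
  s =i t -> seq_distortion s = seq_distortion t.
Proof.
move=> st; apply: eq_eseriesr => k _; congr (_ * _)%E.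
(* Idempotence of the minimum makes order and repetitions irrelevant, so a finite set may be
   sorted. *)
by apply: eq_big_idem => //; exact: minxx.
Qed.

Lemma measurable_sq_dist {R : realType} (s : seq R) :
  measurable_fun [set: R] (sq_dist s).
Proof.
elim: s => [|a s IH].
  have -> : sq_dist [::] = cst (+oo%E : \bar R) by apply/funext => x; rewrite /sq_dist big_nil.
  exact: measurable_cst.
have -> : sq_dist (a :: s) = (fun x => mine (`|x - a| ^+ 2)%:E (sq_dist s x)).
  by apply/funext => x; rewrite /sq_dist big_cons.
apply: measurable_mine => //; apply/measurable_EFinP; apply: measurable_funX.
by apply: measurableT_comp => //; apply: measurable_funB.
Qed.

Lemma distortionE {R : realType} (P : probability (measurableTypeR R) R)
    (hP : forall k : nat, (1 <= k)%N -> P [set (k%:R : R)] = (2 ^- k)%:E)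
    (alpha : {fset R}) :
  distortion P alpha = seq_distortion (enum_fset alpha).
Proof.
pose F (k : nat) : set (measurableTypeR R) := [set k.+1%:R].
have mF k : measurable (F k) by exact: measurable_set1.
have mD : measurable (\bigcup_k F k) by exact: bigcup_measurable.
have tF : trivIset setT F.
  by move=> i j _ _ [x [-> /eqP]]; rewrite eqr_nat eqSS => /eqP.
have PF k : P (F k) = (2 ^- k.+1)%:E by exact: hP.
(* The prescribed masses have partial sums [1 - 2^-n], so they exhaust [P] and the complement of the
   positive integers is null. *)
have PD : P (\bigcup_k F k) = 1%E.
  rewrite measure_semi_bigcup//; apply/cvg_lim => //.
  have h : (1 - 2 ^- n : R) @[n --> \oo] --> (1 - 0 : R).
    by apply: cvgB; [exact: cvg_cst|exact: cvg_exp2].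
  rewrite subr0 in h.
  have {}h : (1 - 2 ^- n : R)%:E @[n --> \oo] --> 1%:E by apply: cvg_EFin h; exact: nearW.
  apply: cvg_trans h.
  apply: near_eq_cvg; apply: nearW => n.
  rewrite (eq_bigr (fun i => (2 ^- i.+1)%:E)) => [|i _]; last exact: PF.
  rewrite sumEFin; congr EFin; elim: n => [|n IH]; first by rewrite big_geq// expr0 invr1 subrr.
  by rewrite big_nat_recr//= -IH [2 ^+ n.+1]exprS invfM; lra.
have PN : P (~` \bigcup_k F k) = 0%E by rewrite probability_setC// PD subee.
rewrite /distortion (ge0_negligible_integral _ _ _ _ PN)//.
- rewrite setTD setCK ge0_integral_bigcup//.
  + apply: eq_eseriesr => k _; rewrite -PF.
    rewrite muleC -(integral_cst P (mF k)); apply: eq_integral => x.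
    by rewrite inE /F /= => ->.
  + by apply: measurable_funTS; exact: measurable_sq_dist.
  + by move=> x _; exact: sq_dist_ge0.
- exact: measurableC.
- exact: measurable_sq_dist.
- by move=> x _; exact: sq_dist_ge0.
Qed.

Theorem theorem4p14 (R : realType) (P : probability (measurableTypeR R) R)
    (hP : forall k : nat, (1 <= k)%N -> P [set (k%:R : R)] = (2 ^- k)%:E)
    (n : nat) (hn : (4 <= n)%N)
    (alpha : {fset R}) (halpha : optimal_set P n alpha) :
  ([set` alpha] =
     [set (k%:R : R) | k in [set k : nat | (1 <= k <= n - 2)%N]] `|`
     [set Av R (n - 1) n; Av_infty R (n + 1)]
   \/
   [set` alpha] =
     [set (k%:R : R) | k in [set k : nat | (1 <= k <= n - 3)%N]] `|`
     [set Av R (n - 2) (n - 1); Av R n (n + 1); Av_infty R (n + 2)])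
  /\ quantization_error P n = ((2 : R) ^ (3%:Z - n%:Z) / 3)%:E.
Proof.
case: halpha => card_alpha dist_alpha.
have [p np] : exists p, n = p.+3 by exists (n - 3)%N; lia.
subst n; set s := sort <=%R (enum_fset alpha).
have mem_s : s =i alpha by move=> x; rewrite mem_sort.
have sorted_s : sorted <%R s by rewrite sort_lt_sorted fset_uniq.
have size_s : (0 < size s <= p.+3)%N by rewrite size_sort.
have dist_s : seq_distortion s = quantization_error P p.+3.
  by rewrite -dist_alpha distortionE//; exact: eq_mem_seq_distortion.
(* Optimality against the competitor [opt_means p]; this also makes the error finite. *)
have dist_le : (seq_distortion s <= (2 ^- p / 3)%:E)%E.
  rewrite dist_s; apply: le_trans (opt_means_distortion p).
  apply: ereal_inf_lbound; exists [fset x in opt_means p]%fset => /=.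
    rewrite card_fseq (leq_trans (size_undup _)) ?size_opt_means// andbT.
    have : 1 \in undup (@opt_means R p) by rewrite mem_undup; case: (p) => *; exact: mem_head.
    by case: (undup _).
  by rewrite distortionE//; apply: eq_mem_seq_distortion => x; rewrite inE.
have := seq_distortion_ge0 s.
case hr : (seq_distortion s) dist_le => [r| |]// r_le _; rewrite lee_fin in r_le.
have [r_ge size_eq] := seq_distortion_min_le p s r size_s sorted_s hr.
have r_eq : r = 2 ^- p / 3 by apply/eqP; rewrite eq_le r_le r_ge.
have [_ /(_ r_eq)[t ht st]] := seq_distortion_min p s r (size_eq r_eq) sorted_s hr.
split; last first.
  rewrite -dist_s hr r_eq -[p.+3]addn3 PoszD; congr (_ / _)%:E.
  by rewrite exprnN; congr (_ ^ _); ring.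
have setE : [set` alpha] = [set` s] by apply/seteqP; split=> x /=; rewrite mem_s.
have headE q : [set (k%:R : R) | k in [set k | (1 <= k <= q)%N]] =
    [set` [seq (k%:R : R) | k <- iota 1 q]].
  apply/seteqP; split=> [x [k /= kq <-]|x /mapP[k]]; last first.
    by rewrite mem_iota add1n ltnS => ? ->; exists k.
  by apply: map_f; rewrite mem_iota add1n ltnS.
rewrite setE st.
rewrite (_ : p.+3 - 1 = p.+2)%N // (_ : p.+3 - 2 = p.+1)%N // (_ : p.+3 - 3 = p)%N; last by lia.
rewrite !addn1 addn2 !Av_pair !Av_inftyE.
(* Each mean [x + p] with [x] in [t] is matched using [Av[k, k+1] = k + 1/3] and
   [Av[k, oo) = k + 1], where [n = p + 3]. In the first case the entry 1 of [t] supplies the integer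
   [p + 1 = n - 2]. *)
rewrite !headE; case: ht => ->; [left|right].
- have -> : iota 1 p.+1 = iota 1 p ++ [:: p.+1] by rewrite -[p.+1]addn1 (iotaD 1 p 1) addn1.
  rewrite map_cat /= nat1r.
  have -> : 7 / 3 + p%:R = p.+2%:R + 1 / 3 :> R by field.
  have -> : 5 + p%:R = p.+4%:R + 1 :> R by ring.
  apply/seteqP; split=> x /=; rewrite !mem_cat !inE.
    by move=> /or4P[->|->|/eqP ->|/eqP ->]; rewrite ?orbT; [left|left|right; left|right; right].
  by move=> [/orP[->|->]|[->|->]]; rewrite ?eqxx ?orbT.
- rewrite /=.
  have -> : 4 / 3 + p%:R = p.+1%:R + 1 / 3 :> R by field.
  have -> : 10 / 3 + p%:R = p.+3%:R + 1 / 3 :> R by field.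
  have -> : 6 + p%:R = p.+1.+4%:R + 1 :> R by ring.
  apply/seteqP; split=> x /=; rewrite !mem_cat !inE.
    move=> /or4P[->|/eqP ->|/eqP ->|/eqP ->]; [by left|right..|by right; right].
    + by left; left.
    + by left; right.
  by move=> [->|[[->|->]|->]]; rewrite ?eqxx ?orbT.
Qed.
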